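(* Let $\mathbb{F}$ be either $\mathbb{R}$ or $\mathbb{C}$, let $X$ be an infinite-dimensional vector space over $\mathbb{F}$, and let $N$ be a norm on $X$. Then there exist a norm $N'$ on $X$ as well as a proper seminorm $S$ on $X$ such that both $N'$ and $S$ are ubiquitously discontinuous in $X$ with respect to the norm topology induced by $N$.
   Context: A seminorm on $X$ is a function $S\colon X\to\mathbb{R}$ with $S(x)\ge 0$, $S(\alpha x)=|\alpha|S(x)$ and $S(x+y)\le S(x)+S(y)$ for all $x,y\in X$, $\alpha\in\mathbb{F}$; a norm is a seminorm with $S(x)>0$ for all $x\neq 0$. A seminorm $S$ is called proper if it does not vanish identically and $S(x)=0$ for some $x\neq 0$ (equivalently, $\ker S=\{x\in X: S(x)=0\}$ is a nontrivial proper subspace of $X$). A function $X\to\mathbb{R}$ is ubiquitously discontinuous in $X$ with respect to a given topology on $X$ if it is discontinuous at every point of $X$. *)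

(* Defs.v *)
From HB Require Import structures.
From mathcomp Require Import all_boot all_order all_algebra.
From mathcomp Require Import complex.
From mathcomp Require Import all_classical all_reals.
From mathcomp Require Import topology normedtype.

Set Implicit Arguments.
Unset Strict Implicit.
Unset Printing Implicit Defensive.

Import Order.TTheory GRing.Theory Num.Theory.
Import numFieldNormedType.Exports.

Local Open Scope classical_set_scope.
Local Open Scope ring_scope.

Variant base_field := RealBase | ComplexBase.

Definition scalars (R : realType) (k : base_field) : numFieldType :=
  match k with
  | RealBase => R
  | ComplexBase => R[i]
  end.

(* The library norm on R[i] takes values in R[i]; homogeneity of a real-valued
   seminorm needs the R-valued modulus instead. *)
Definition modulus (R : realType) (k : base_field) : scalars R k -> R :=
  match k return scalars R k -> R with
  | RealBase => fun a : R => `|a|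
  | ComplexBase => fun a : R[i] => ComplexField.Normc.normc a
  end.

Definition infinite_dimensional (F : fieldType) (X : lmodType F) : Prop :=
  ~ exists (n : nat) (e : 'I_n -> X),
      forall x : X, exists c : 'I_n -> F, x = \sum_(i < n) c i *: e i.

Section Seminorms.
Variables (R : realType) (k : base_field) (X : lmodType (scalars R k)).

Definition is_seminorm (S : X -> R) : Prop :=
  [/\ forall x, 0 <= S x,
      forall (a : scalars R k) x, S (a *: x) = modulus a * S x &
      forall x y, S (x + y) <= S x + S y].

Definition is_norm (N : X -> R) : Prop :=
  is_seminorm N /\ forall x, x != 0 -> 0 < N x.

Definition is_proper_seminorm (S : X -> R) : Prop :=
  [/\ is_seminorm S, exists x, S x != 0 & exists2 x, x != 0 & S x = 0].

End Seminorms.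

(* The carrier of X with the topology whose open sets are the A such that every
   point x of A is the center of some ball {y | N (y - x) < e} contained in A.
   These sets form a topology for every function N; it is the norm topology when
   N is a norm. *)
Definition norm_topology (R : realType) (V : zmodType) (N : V -> R) : Type := V.

Section NormTopology.
Variables (R : realType) (V : zmodType) (N : V -> R).

Definition norm_open (A : set V) : Prop :=
  forall x, A x -> exists2 e : R, 0 < e & [set y | N (y - x) < e] `<=` A.

Let norm_openT : norm_open setT.
Proof. by move=> x _; exists 1. Qed.

Let norm_openI : setI_closed norm_open.
Proof.
move=> A B oA oB x [/oA [e e0 eA] /oB [d d0 dB]].
exists (Num.min e d); first by rewrite lt_min e0.
by move=> y /=; rewrite lt_min => /andP[ye yd]; split; [exact: eA|exact: dB].
Qed.

Let norm_open_bigU (I : Type) (f : I -> set V) :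
  (forall i, norm_open (f i)) -> norm_open (\bigcup_i f i).
Proof.
move=> of_ x [i _ /of_ [e e0 ef]]; exists e => // y ye.
by exists i => //; exact: ef.
Qed.

HB.instance Definition _ := Choice.on (norm_topology N).
HB.instance Definition _ := isOpenTopological.Build (norm_topology N)
  norm_openT norm_openI norm_open_bigU.

End NormTopology.

Definition ubiquitously_discontinuous (T U : topologicalType) (f : T -> U) :
  Prop := forall x : T, ~ {for x, continuous f}.

(* Main.v *)
Require Import Defs.
From HB Require Import structures.
From mathcomp Require Import all_boot all_order all_algebra.
From mathcomp Require Import complex.
From mathcomp Require Import all_classical all_reals.
From mathcomp Require Import topology normedtype.
From mathcomp Require Import ring.

Set Implicit Arguments.
Unset Strict Implicit.
Unset Printing Implicit Defensive.

Import Order.TTheory GRing.Theory Num.Theory.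
Import numFieldNormedType.Exports.

Local Open Scope classical_set_scope.
Local Open Scope ring_scope.


(** An infinite-dimensional normed space carries a linear functional [f] that is
    not bounded by any multiple of [N]; then [S x = |f x|] and [N' x = N x + |f x|]
    are the required functions.  [N'] inherits positivity from [N], and [S] is
    proper because a functional with trivial kernel would embed the space in its
    field of scalars.  Neither is bounded by a multiple of [N], and a seminorm
    that is [N]-continuous at a single point is bounded by a multiple of [N]
    ([unbounded_ubiquitously_discontinuous]).

    The functional comes from [exists_growing_functional].  As long as a linear
    functional is defined on a finite-dimensional subspace only, there is a vector
    outside its domain, where the value can be prescribed freely; at the [n]-th
    step the new value is taken of modulus larger than [n * N x].  The union of
    the resulting chain of partial functionals extends to the whole space by
    Zorn's lemma ([linear_graph_extension]).  Partial functionals are represented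
    by their graphs, so that unions and extensions are plain set operations and
    no basis is ever chosen. *)

(** * Partial linear functionals *)

Section LinearGraph.
Variables (F : fieldType) (X : lmodType F).
Implicit Types (G H : set (X * F)) (x y : X) (a b c : F).

Definition linear_graph G : Prop :=
  [/\ G (0, 0),
      forall a x y b c, G (x, b) -> G (y, c) -> G (a *: x + y, a * b + c) &
      forall c, G (0, c) -> c = 0].

Definition domain G : set X := [set x | exists a, G (x, a)].

Lemma linear_graphZ G a x b :
  linear_graph G -> G (x, b) -> G (a *: x, a * b).
Proof. by case=> G0 GL _ /(GL a) /(_ G0); rewrite !addr0. Qed.

Lemma linear_graph_fun G x b c :
  linear_graph G -> G (x, b) -> G (x, c) -> b = c.
Proof.
move=> [G0 GL G1] Gb Gc; apply/eqP; rewrite eq_sym -subr_eq0; apply/eqP/G1.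
by have := GL (-1) _ _ _ _ Gb Gc; rewrite scaleN1r mulN1r addNr addrC.
Qed.

Lemma linear_graph0 : linear_graph [set (0, 0)].
Proof.
split=> [//|a x y b c [-> ->] [-> ->]|c [->//]] /=.
by rewrite scaler0 mulr0 !addr0.
Qed.

Lemma bigcup_linear_graph (I : Type) (D : set I) (G : I -> set (X * F)) :
    D !=set0 -> (forall i, D i -> linear_graph (G i)) ->
    (forall i j, D i -> D j -> G i `<=` G j \/ G j `<=` G i) ->
  linear_graph (\bigcup_(i in D) G i).
Proof.
move=> [i0 Di0] lG totG; split.
- by exists i0 => //; case: (lG _ Di0).
- move=> a x y b c [i Di Gi] [j Dj Gj].
  have [sij|sji] := totG _ _ Di Dj.
    by exists j => //; case: (lG _ Dj) => _ + _; apply=> //; exact: sij.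
  by exists i => //; case: (lG _ Di) => _ + _; apply=> //; exact: sji.
- by move=> c [i Di Gi]; case: (lG _ Di) => _ _; exact.
Qed.

(** The sum of [G] and the line through [(x, a)]. *)
Definition extend_graph G x a : set (X * F) :=
  [set p | exists c, G (p.1 - c *: x, p.2 - c * a)].

Lemma sub_extend_graph G x a : G `<=` extend_graph G x a.
Proof. by move=> [y b] Gyb; exists 0; rewrite scale0r mul0r !subr0. Qed.

Lemma mem_extend_graph G x a : linear_graph G -> extend_graph G x a (x, a).
Proof. by case=> G0 _ _; exists 1; rewrite scale1r mul1r !subrr. Qed.

(** A nonzero multiple of [x] in the domain of [G] would put [x] itself there;
    hence the line added to [G] contributes nothing above [0]. *)
Lemma linear_extend_graph G x a :
  linear_graph G -> ~ domain G x -> linear_graph (extend_graph G x a).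
Proof.
move=> lG xG; have [G0 GL G1] := lG; split.
- exact: sub_extend_graph.
- move=> d y z b c [e /= Gy] [g /= Gz]; exists (d * e + g) => /=.
  have := GL d _ _ _ _ Gy Gz; congr (G (_, _)).
    by rewrite scalerBr scalerDl scalerA opprD addrACA.
  by rewrite mulrBr mulrDl mulrA opprD addrACA.
- move=> b [c /=]; rewrite sub0r => Gc.
  have [c0|c0] := eqVneq c 0.
    by move: Gc; rewrite c0 scale0r mul0r oppr0 subr0 => /G1.
  case: xG; exists (- c^-1 * (b - c * a)).
  have := linear_graphZ (- c^-1) lG Gc.
  by rewrite scalerN scaleNr opprK scalerA mulVf // scale1r.
Qed.

(** A maximal graph containing [G0] is total, since [linear_extend_graph] would
    enlarge it at any missing point.  Zorn's lemma is applied to the sets [A]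
    such that [G0 `|` A] is a linear graph, so that the empty chain has an upper
    bound as well. *)
Lemma linear_graph_extension (G0 : set (X * F)) :
    linear_graph G0 ->
  exists2 f : X -> F,
    (forall a x y, f (a *: x + y) = a * f x + f y) &
    (forall x a, G0 (x, a) -> f x = a).
Proof.
move=> lG0.
have [C CP totC|A [lA maxA]] :=
    @Zorn_bigcup _ [set A | linear_graph (G0 `|` A)].
  (* [bigcupUr], which distributes [G0] over the union, needs a nonempty chain *)
  have [->|C0] := eqVneq C set0; first by rewrite /= bigcup_set0 setU0.
  have {}C0 : C !=set0 by apply/set0P.
  rewrite /= -bigcupUr //.
  apply: bigcup_linear_graph => // U V CU CV.
  by have [sUV|sVU] := totC _ _ CU CV; [left|right]; exact: setUS.
set G := G0 `|` A in lA.
have totG x : domain G x.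
  apply: contrapT => xG; pose H := extend_graph G x 0.
  have GH : G `<=` H by exact: sub_extend_graph.
  have Hx : H (x, 0) by exact: mem_extend_graph.
  apply: (maxA H); last first.
    rewrite /= (setUidr _); first exact: linear_extend_graph.
    by move=> p G0p; apply: GH; left.
  split; first by move=> p Ap; apply: GH; right.
  by move=> /(_ _ Hx) Ax; apply: xG; exists 0; right.
have [f fG] := choice totG.
exists f => [a x y|x a G0x]; apply: (linear_graph_fun lA).
- exact: fG.
- by case: lA => _ + _; apply; exact: fG.
- exact: fG.
- by left.
Qed.

(** * Functionals with prescribed growth *)

Definition finitely_spanned (D : set X) : Prop :=
  exists n (e : 'I_n -> X),
    forall x, D x -> exists c : 'I_n -> F, x = \sum_(i < n) c i *: e i.

Lemma finitely_spanned_extend_graph G x a :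
  finitely_spanned (domain G) -> finitely_spanned (domain (extend_graph G x a)).
Proof.
move=> [n [e eG]]; exists n.+1, (fun i => oapp e x (unlift ord0 i)).
move=> y [b [c /= Gy]].
have [|d yE] := eG (y - c *: x); first by exists (b - c * a).
exists (fun i => oapp d c (unlift ord0 i)).
rewrite big_ord_recl unlift_none /=.
under eq_bigr do rewrite liftK /=.
by rewrite -yE addrC subrK.
Qed.

(** Only the values at the vectors chosen at each step are constrained, and such
    a vector always exists because a finitely spanned domain is not all of [X].
    The predicate [P] keeps the construction independent of any norm on the
    scalars. *)
Lemma exists_growing_functional (P : nat -> X -> F -> Prop) :
    infinite_dimensional X -> (forall n x, exists a, P n x a) ->
  exists2 f : X -> F,
    (forall a x y, f (a *: x + y) = a * f x + f y) &
    forall n, exists x, P n x (f x).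
Proof.
move=> infX exP.
pose good G := linear_graph G /\ finitely_spanned (domain G).
(* the first component makes the step number available to the dependent choice *)
pose R (p q : nat * {G | good G}) :=
  [/\ q.1 = p.1.+1, sval p.2 `<=` sval q.2 &
      exists x a, sval q.2 (x, a) /\ P p.1 x a].
have stepR p : {q | R p q}.
  apply: cid; case: p => n [G [lG fG]].
  have [x xG] : exists x, ~ domain G x.
    apply/existsNP => totG; apply: infX.
    by case: fG => m [e eG]; exists m, e => x; exact: eG.
  have [a Pa] := exP n x.
  have gH : good (extend_graph G x a).
    split; first exact: linear_extend_graph.
    exact: finitely_spanned_extend_graph.
  exists (n.+1, exist _ _ gH); split=> //=; first exact: sub_extend_graph.
  by exists x, a; split=> //; exact: mem_extend_graph.
have good0 : good [set (0, 0)].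
  split; first exact: linear_graph0.
  exists 0, (fun=> 0) => x [a [-> _]]; exists (fun=> 0).
  by rewrite big_ord0.
have [s [s0 sR]] := dependent_choice stepR (0, exist _ _ good0).
pose G n := sval (s n).2.
have s1 n : (s n).1 = n.
  by elim: n => [|n IH]; [rewrite s0|case: (sR n) => ->; rewrite IH].
have incG m n : (m <= n)%N -> G m `<=` G n.
  elim: n => [|n IH]; first by rewrite leqn0 => /eqP->.
  rewrite leq_eqVlt => /predU1P[->//|/IH sG]; apply: (subset_trans sG).
  by case: (sR n).
have [f flin fG] : exists2 f : X -> F,
    (forall a x y, f (a *: x + y) = a * f x + f y) &
    forall x a, (\bigcup_(n in setT) G n) (x, a) -> f x = a.
  apply: linear_graph_extension; apply: bigcup_linear_graph.
  - by exists 0.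
  - by move=> n _; case: (svalP (s n).2).
  - move=> m n _ _; have [mn|/ltnW nm] := leqP m n; [left|right]; exact: incG.
exists f => // n; have [_ _ [x [a [Gx Pn]]]] := sR n.
have fxa : f x = a by apply: fG; exists n.+1.
by exists x; rewrite s1 in Pn; rewrite fxa.
Qed.

(** Were [f] injective, every [x] would equal [(f x / f y) *: y] for a fixed [y]
    with [f y != 0]. *)
Lemma linear_functional_kernel (f : X -> F) :
    infinite_dimensional X -> (forall a x y, f (a *: x + y) = a * f x + f y) ->
  exists2 x, x != 0 & f x = 0.
Proof.
move=> infX flin; apply: contrapT => injf.
have f0P x : f x = 0 -> x = 0.
  by move=> fx; apply/eqP; apply: contrapT => /negP x0; apply: injf; exists x.
have [f0|] := pselect (forall x, f x = 0).
  apply: infX; exists 0, (fun=> 0) => x; exists (fun=> 0).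
  by rewrite big_ord0; exact: f0P.
move=> /existsNP[y /eqP fy]; apply: infX; exists 1, (fun=> y) => x.
exists (fun=> f x / f y); rewrite big_ord1; apply/eqP.
rewrite eq_sym -subr_eq0 -oppr_eq0 opprB -scaleNr addrC; apply/eqP/f0P.
by rewrite flin mulNr divfK // addNr.
Qed.

End LinearGraph.

(** * Discontinuity of seminorms *)

Section Modulus.
Variables (R : realType) (k : base_field).
Implicit Types a b : scalars R k.

Lemma modulus_ge0 a : 0 <= modulus a.
Proof. by case: k a => [a|[x y]] /=; rewrite ?normr_ge0 ?sqrtr_ge0. Qed.

Lemma modulusM a b : modulus (a * b) = modulus a * modulus b.
Proof. by case: k a b => a b /=; rewrite ?normrM ?ComplexField.Normc.normcM. Qed.

Lemma ler_modulusD a b : modulus (a + b) <= modulus a + modulus b.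
Proof. by case: k a b => a b /=; [exact: ler_normD|exact: le_normcD]. Qed.

Lemma modulus0 : modulus (0 : scalars R k) = 0.
Proof. by case: k; [exact: normr0|exact: ComplexField.Normc.normc0]. Qed.

Lemma modulus_surj (t : R) : 0 <= t -> exists a, modulus a = t.
Proof.
move=> t0; case: k => /=; first by exists t; rewrite ger0_norm.
by exists (t%:C)%C; rewrite /= expr0n addr0 sqrtr_sqr ger0_norm.
Qed.

End Modulus.

Section Discontinuity.
Variables (R : realType) (k : base_field) (X : lmodType (scalars R k)).
Implicit Types N S : X -> R.

Definition unbounded N S : Prop := forall C : R, exists x, C * N x < S x.

Lemma seminorm0 S : is_seminorm S -> S 0 = 0.
Proof. by case=> _ SZ _; rewrite -(scale0r 0) SZ modulus0 mul0r. Qed.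

Lemma seminormD N S :
  is_seminorm N -> is_seminorm S -> is_seminorm (fun x => N x + S x).
Proof.
move=> [N0 NZ ND] [S0 SZ SD]; split=> [x|a x|x y].
- by rewrite addr_ge0.
- by rewrite NZ SZ mulrDr.
- by rewrite addrACA lerD.
Qed.

Lemma seminorm_functional (f : X -> scalars R k) :
    (forall a x y, f (a *: x + y) = a * f x + f y) ->
  is_seminorm (fun x => modulus (f x)).
Proof.
move=> flin.
have fD x y : f (x + y) = f x + f y by rewrite -[x]scale1r flin mul1r scale1r.
have f0 : f 0 = 0 by apply: (addrI (f 0)); rewrite -fD !addr0.
split=> [x|a x|x y]; first exact: modulus_ge0.
- by rewrite -[a *: x]addr0 flin f0 addr0 modulusM.
- by rewrite fD ler_modulusD.
Qed.

(** Continuity at one point [x] bounds [S] near [x], hence, by subadditivity,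
    on some ball around the origin, hence, by homogeneity, by a multiple of [N]. *)
Lemma unbounded_ubiquitously_discontinuous N S :
    is_norm N -> is_seminorm S -> unbounded N S ->
  ubiquitously_discontinuous (S : norm_topology N -> R).
Proof.
move=> [[N0 NZ ND] Npos] sS unbS x cS.
have [S0 SZ SD] := sS.
have := (@cvgrPdist_lt R R (norm_topology N) (nbhs (x : norm_topology N))
  _ S (S x)).1 cS 1 ltr01.
case=> B [oB Bx sB].
have [e e0 eB] := oB _ Bx.
pose M := S x + 1 + S (- x).
have ballM z : N z < e -> S z < M.
  move=> ze; have := sB (x + z) (eB (x + z) _) => /=.
  rewrite addrAC subrr add0r => /(_ ze); rewrite ltr_distlC => /andP[_ Sxz].
  have := SD (- x) (x + z); rewrite addKr => /le_lt_trans; apply.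
  by rewrite addrC ltrD2r.
(* rescaling [y] to norm [e / 2], inside the ball, makes [S] exceed [M] there *)
have [y yS] := unbS (M / (e / 2)).
have y0 : y != 0.
  by apply: contraTneq yS => ->; rewrite !seminorm0 ?mulr0 ?ltxx.
have Ny := Npos _ y0.
have [a aE] : exists a : scalars R k, modulus a = e / 2 / N y.
  by apply: modulus_surj; rewrite !divr_ge0 // ltW.
have := ballM (a *: y); rewrite NZ SZ aE divfK ?gt_eqF //.
rewrite ltr_pdivrMr // ltr_pMr // ltr1n => /(_ isT); apply/negP.
rewrite -leNgt ltW //.
have -> : M = e / 2 / N y * (M / (e / 2) * N y).
  by field; rewrite !gt_eqF.
by rewrite ltr_pM2l // !divr_gt0.
Qed.

End Discontinuity.

Theorem theorem4 (R : realType) (k : base_field) (X : lmodType (scalars R k))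
    (infX : infinite_dimensional X) (N : X -> R) (normN : is_norm N) :
  exists N' S : X -> R,
    [/\ is_norm N',
        is_proper_seminorm S,
        ubiquitously_discontinuous (N' : norm_topology N -> R) &
        ubiquitously_discontinuous (S : norm_topology N -> R)].
Proof.
have [sN Npos] := normN; have [N0 _ _] := sN.
have [n x|f flin fgrow] :=
    @exists_growing_functional _ X (fun n x a => n%:R * N x < modulus a) infX.
  have [|a aE] := @modulus_surj R k (n%:R * N x + 1).
    by rewrite addr_ge0 // mulr_ge0.
  by exists a; rewrite aE ltrDl.
pose S x := modulus (f x).
have sS : is_seminorm S by exact: seminorm_functional.
have unbS : unbounded N S.
  move=> C; have [x Sx] := fgrow (Num.bound `|C|); exists x.
  apply: le_lt_trans Sx; rewrite ler_wpM2r //.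
  exact: le_trans (ler_norm C) (ltW (archi_boundP (normr_ge0 C))).
have sN' := seminormD sN sS.
exists (fun x => N x + S x), S; split.
- by split=> // x /Npos; case: sS => S0 _ _ Nx; rewrite ltr_wpDr.
- split=> //.
    by have [x] := unbS 0; rewrite mul0r => Sx; exists x; rewrite gt_eqF.
  have [x x0 fx] := linear_functional_kernel infX flin.
  by exists x => //; rewrite /S fx modulus0.
- apply: unbounded_ubiquitously_discontinuous => // C.
  by have [x Sx] := unbS C; exists x; rewrite ltr_wpDl.
- exact: unbounded_ubiquitously_discontinuous.
Qed.
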